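(* Let $\mathcal{I}$ be a non-empty collection of locally compact metric spaces, and let $I\mapsto (C(I),\alpha_I)$ be a functorial assignment of a locally compact metric space $C(I)$ and a dense isometric embedding $\alpha_I: I\to C(I)$ to each $I\in\mathcal{I}$. Then the assignment $F:\mathbf{UBunC^*Alg}_{\mathcal{I}}\to\mathbf{UBunC^*Alg}_{C(\mathcal{I})}$ given on objects by $\mathcal{A}_I\mapsto\tilde{\mathcal{A}}_{C(I)}$ and on morphisms by $(\alpha,\beta)\mapsto (C(\alpha),\beta)$ is a functor.
   Context: For a metric space $I$, $UC_b(I)$ is the C*-algebra of bounded uniformly continuous functions $I\to\mathbb{C}$. C*-algebras are not assumed unital. A $UC_b$ bundle of C*-algebras over a metric space $I$, written $((\mathfrak{A}_\hbar,\phi^I_\hbar)_{\hbar\in I},\mathfrak{A})$, is a family of C*-algebras $(\mathfrak{A}_\hbar)_{\hbar\in I}$, a C*-algebra $\mathfrak{A}$, and *-homomorphisms $\phi^I_\hbar:\mathfrak{A}\to\mathfrak{A}_\hbar$ such that: (i) each $\phi^I_\hbar$ is surjective and $\|a\|=\sup_{\hbar\in I}\|\phi^I_\hbar(a)\|_\hbar$ for all $a\in\mathfrak{A}$; (ii) for each $f\in UC_b(I)$ and $a\in\mathfrak{A}$ there is an element $fa\in\mathfrak{A}$ with $\phi^I_\hbar(fa)=f(\hbar)\phi^I_\hbar(a)$ for all $\hbar\in I$; (iii) for each $a\in\mathfrak{A}$, the function $\hbar\mapsto\|\phi^I_\hbar(a)\|_\hbar$ is in $UC_b(I)$. A homomorphism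 from $\mathcal{A}_I=((\mathfrak{A}_\hbar,\phi^I_\hbar)_{\hbar\in I},\mathfrak{A})$ to $\mathcal{B}_J=((\mathfrak{B}_\hbar,\phi^J_\hbar)_{\hbar\in J},\mathfrak{B})$ is a pair $\sigma=(\alpha,\beta)$ where $\alpha:I\to J$ is a metric map (i.e. $d_J(\alpha(x),\alpha(y))\le d_I(x,y)$), $\beta:\mathfrak{A}\to\mathfrak{B}$ is a *-homomorphism, and for all $a_1,a_2\in\mathfrak{A}$, $\hbar\in I$: if $\phi^I_\hbar(a_1)=\phi^I_\hbar(a_2)$, then $\phi^J_{\alpha(\hbar)}(\beta(a_1))=\phi^J_{\alpha(\hbar)}(\beta(a_2))$. Composition is componentwise. A map is proper if preimages of compact sets are compact. A dense isometric embedding is an isometry onto its image whose image is dense. The assignment $I\mapsto(C(I),\alpha_I)$ is functorial if: (i) for each proper metric map $f:I\to J$ with $I,J\in\mathcal{I}$ there is a (continuous) map $C(f):C(I)\to C(J)$ with $C(f)\circ\alpha_I=\alpha_J\circ f$; (ii) $C(g\circ f)=C(g)\circ C(f)$ for proper metric maps $f:I\to J$, $g:J\to K$. $\mathbf{UBunC^*Alg}_{\mathcal{I}}$ has as objects the $UC_b$ bundles of C*-algebras over base spaces $I\in\mathcal{I}$ and as morphisms the homomorphisms $(\alpha,\beta)$ with $\alpha$ proper. With $C(\mathcal{I})=\{C(I): I\in\mathcal{I}\}$, $\mathbf{UBunC^*Alg}_{C(\mathcal{I})}$ is defined in the same way, with objects the $UC_b$ bundles over spaces in $C(\mathcal{I})$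 and morphisms the homomorphisms acting as proper maps between base spaces. For $\mathcal{A}_I=((\mathfrak{A}_\hbar,\phi^I_\hbar)_{\hbar\in I},\mathfrak{A})$, $\tilde{\mathcal{A}}_{C(I)}$ denotes the minimal extension of $\mathcal{A}_I$ associated with $\alpha_I$ (a minimal extension associated with $\alpha_I$ is a $UC_b$ bundle over $C(I)$ with a homomorphism $(\alpha_I,\beta)$ from $\mathcal{A}_I$ such that $\beta$ is injective with dense range; it is unique up to isomorphism), realized concretely as $\tilde{\mathcal{A}}_{C(I)}=((\mathfrak{A}/\mathcal{K}_j,\phi^{C(I)}_j)_{j\in C(I)},\mathfrak{A})$, where $\mathcal{K}_j$ is the closed two-sided ideal of all $a\in\mathfrak{A}$ such that $\lim_\delta\|\phi^I_{i_\delta}(a)\|_{i_\delta}=0$ for every net $\{i_\delta\}$ in $I$ with $\alpha_I(i_\delta)\to j$, and $\phi^{C(I)}_j$ is the quotient map. In particular its algebra of sections is the same $\mathfrak{A}$.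
   Formalization: The formal statement also assumes that C(f) is proper for each proper metric map f; with C(f) merely continuous, (C(f), β) need not be a morphism of the target category (e.g. {1/n} included in (0,1], with C((0,1]) = [0,1] and zero bundles). *)

(* Defs.v *)
From HB Require Import structures.
From mathcomp Require Import all_boot all_order all_algebra.
From mathcomp Require Import complex.
From mathcomp Require Import boolp classical_sets reals topology normedtype.

Set Implicit Arguments.
Unset Strict Implicit.
Unset Printing Implicit Defensive.

Import Order.TTheory GRing.Theory Num.Theory.
Import numFieldNormedType.Exports.

Local Open Scope classical_set_scope.
Local Open Scope ring_scope.
Local Open Scope complex_scope.

(** * Possibly non-unital C*-algebras *)

(* MathComp algebras are unital, so the multiplication is part of the mixin.
   The norm of a normed R[i]-module takes its values in R[i]. *)
HB.mixin Record CompleteNormedModule_isCStarAlgebra (R : realType) A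
    & CompleteNormedModule R[i] A := {
  smul : A -> A -> A ;
  star : A -> A ;
  smulA : forall a b c, smul a (smul b c) = smul (smul a b) c ;
  smulDl : forall a b c, smul (a + b) c = smul a c + smul b c ;
  smulDr : forall a b c, smul a (b + c) = smul a b + smul a c ;
  smulZl : forall (k : R[i]) a b, smul (k *: a) b = k *: smul a b ;
  smulZr : forall (k : R[i]) a b, smul a (k *: b) = k *: smul a b ;
  starK : forall a, star (star a) = a ;
  starD : forall a b, star (a + b) = star a + star b ;
  starZ : forall (k : R[i]) a, star (k *: a) = k^* *: star a ;
  starM : forall a b, star (smul a b) = smul (star b) (star a) ;
  norm_smul : forall a b, `|smul a b| <= `|a| * `|b| ;
  norm_cstar : forall a, `|smul (star a) a| = `|a| ^+ 2
}.

#[short(type="cstarAlgType")]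
HB.structure Definition CStarAlgebra (R : realType) :=
  { A of CompleteNormedModule R[i] A & CompleteNormedModule_isCStarAlgebra R A }.

Record starhom (R : realType) (A B : cstarAlgType R) := StarHom {
  starhom_fun :> A -> B ;
  starhom_linear : linear starhom_fun ;
  starhomM : {morph starhom_fun : a b / smul a b >-> smul a b} ;
  starhom_star : {morph starhom_fun : a / star a >-> star a}
}.

Lemma starhomP (R : realType) (A B : cstarAlgType R) (f g : starhom A B) :
  (f : A -> B) = g -> f = g.
Proof.
case: f g => [f lf mf sf] [g lg mg sg] /= fg; case: _ / fg lg mg sg => lg mg sg.
by congr StarHom; exact: Prop_irrelevance.
Qed.

Lemma id_linear_subproof (R : realType) (A : cstarAlgType R) :
  linear (@id A).
Proof. by []. Qed.

Definition starhom_id (R : realType) (A : cstarAlgType R) : starhom A A :=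
  @StarHom R A A id (@id_linear_subproof R A)
    (fun _ _ => erefl) (fun _ => erefl).

Section starhom_comp.
Context (R : realType) (A B D : cstarAlgType R).
Context (g : starhom B D) (f : starhom A B).

Lemma comp_linear_subproof : linear (g \o f).
Proof. by move=> k u v /=; rewrite !starhom_linear. Qed.

Lemma comp_mul_subproof : {morph g \o f : a b / smul a b >-> smul a b}.
Proof. by move=> a b /=; rewrite !starhomM. Qed.

Lemma comp_star_subproof : {morph g \o f : a / star a >-> star a}.
Proof. by move=> a /=; rewrite !starhom_star. Qed.

Definition starhom_comp : starhom A D :=
  StarHom comp_linear_subproof comp_mul_subproof comp_star_subproof.

End starhom_comp.

(* [q] exhibits [Q] as the C*-algebra [A / K] with its quotient norm. *)
Definition is_quotient_map (R : realType) (A Q : cstarAlgType R) (K : set A)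
    (q : starhom A Q) : Prop :=
  [/\ forall b, exists a, q a = b,
      forall a, q a = 0 <-> K a &
      forall a, complex.Re `|q a| = inf [set complex.Re `|a + k| | k in K]].

(** * Maps of metric spaces and nets *)

Definition metric_map (R : realType) (I J : metricType R) (f : I -> J) : Prop :=
  forall x y, mdist (f x) (f y) <= mdist x y.

Definition proper_map (S T : topologicalType) (f : S -> T) : Prop :=
  forall K : set T, compact K -> compact (f @^-1` K).

Definition dense_isometric_embedding (R : realType) (I J : metricType R)
    (f : I -> J) : Prop :=
  (forall x y, mdist (f x) (f y) = mdist x y) /\ dense (range f).

(* [R[i]^o] is [R[i]] seen as a normed module over itself. *)
Definition UCb (R : realType) (I : metricType R) (f : I -> R[i]^o) : Prop :=
  [bounded f x | x in [set: I]] /\ unif_continuous f.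

Definition directed_order (D : Type) (le : D -> D -> Prop) : Prop :=
  [/\ inhabited D,
      forall d, le d d,
      forall d e f, le d e -> le e f -> le d f &
      forall d e, exists f, le d f /\ le e f].

(* [x @ tails le --> l] is convergence of the net [x] to [l]. *)
Definition tails (D : Type) (le : D -> D -> Prop) : set_system D :=
  [set A | exists d0, forall d, le d0 d -> A d].

(** * Bundles *)

(* Condition [bundle_norm] bounds the set whose supremum is taken in
   [bundle_sup]; over the empty base space that supremum is [0]. *)
Record ucb_bundle (R : realType) (I : metricType R) (A : cstarAlgType R) := {
  fiber : I -> cstarAlgType R ;
  proj : forall h : I, starhom A (fiber h) ;
  bundle_surj : forall h, forall b : fiber h, exists a, proj h a = b ;
  bundle_sup : forall a : A,
    complex.Re `|a| = sup (range (fun h => complex.Re `|proj h a|)) ;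
  bundle_mul : forall (f : I -> R[i]^o) (a : A), UCb f ->
    exists fa : A, forall h, proj h fa = f h *: proj h a ;
  bundle_norm : forall a : A, UCb (fun h => `|proj h a| : R[i]^o)
}.

Definition bundle_hom (R : realType) (I J : metricType R)
    (A B : cstarAlgType R) (E : ucb_bundle I A) (E' : ucb_bundle J B)
    (alpha : I -> J) (beta : starhom A B) : Prop :=
  metric_map alpha /\
  forall (a1 a2 : A) (h : I), proj E h a1 = proj E h a2 ->
    proj E' (alpha h) (beta a1) = proj E' (alpha h) (beta a2).

Definition minimal_extension (R : realType) (I J : metricType R)
    (A B : cstarAlgType R) (alpha : I -> J)
    (E : ucb_bundle I A) (E' : ucb_bundle J B) (beta : starhom A B) : Prop :=
  [/\ bundle_hom E E' alpha beta, injective beta & dense (range beta)].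

Definition vanishing_ideal (R : realType) (I J : metricType R)
    (A : cstarAlgType R) (alpha : I -> J) (E : ucb_bundle I A) (j : J) :
    set A :=
  [set a | forall (D : Type) (le : D -> D -> Prop) (x : D -> I),
     directed_order le ->
     alpha (x d) @[d --> tails le] --> j ->
     (`|proj E (x d) a| : R[i]^o) @[d --> tails le] --> (0 : R[i]^o)].

(* The concrete realization of the minimal extension: sections [A], fibres
   [A / vanishing_ideal alpha E j], projections the quotient maps. *)
Definition quotient_extension (R : realType) (I J : metricType R)
    (A : cstarAlgType R) (alpha : I -> J)
    (E : ucb_bundle I A) (E' : ucb_bundle J A) : Prop :=
  minimal_extension alpha E E' (starhom_id A) /\
  forall j, is_quotient_map (vanishing_ideal alpha E j) (proj E' j).

(** * Categories *)

Record category := Category {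
  obj :> Type ;
  mor : obj -> obj -> Type ;
  idmor : forall X, mor X X ;
  compmor : forall X Y Z, mor Y Z -> mor X Y -> mor X Z ;
  comp1mor : forall X Y (f : mor X Y), compmor (idmor Y) f = f ;
  compmor1 : forall X Y (f : mor X Y), compmor f (idmor X) = f ;
  compmorA : forall X Y Z W (h : mor Z W) (g : mor Y Z) (f : mor X Y),
    compmor h (compmor g f) = compmor (compmor h g) f
}.

Definition is_functor (X Y : category) (Fo : X -> Y)
    (Fm : forall a b : X, mor a b -> mor (Fo a) (Fo b)) : Prop :=
  (forall a, Fm a a (idmor a) = idmor (Fo a)) /\
  (forall a b c (g : mor b c) (f : mor a b),
     Fm a c (compmor g f) = compmor (Fm b c g) (Fm a b f)).

(* Bundles over base spaces in the collection [S]. *)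
Record ubun (R : realType) (S : metricType R -> Prop) := UBun {
  base : metricType R ;
  baseP : S base ;
  sections : cstarAlgType R ;
  bundle : ucb_bundle base sections
}.

Record ubun_hom (R : realType) (S : metricType R -> Prop) (X Y : ubun S) :=
  UBunHom {
    base_map : base X -> base Y ;
    sec_map : starhom (sections X) (sections Y) ;
    ubun_bundle_hom : bundle_hom (bundle X) (bundle Y) base_map sec_map ;
    ubun_proper : proper_map base_map
  }.

Section ubun_category.
Context (R : realType) (S : metricType R -> Prop).

Lemma ubun_homP (X Y : ubun S) (f g : ubun_hom X Y) :
  base_map f = base_map g -> sec_map f = sec_map g -> f = g.
Proof.
case: f g => [f1 f2 fh fp] [g1 g2 gh gp] /= e1 e2.
case: _ / e1 gh gp => gh gp; case: _ / e2 gh => gh.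
by congr UBunHom; exact: Prop_irrelevance.
Qed.

Lemma id_bundle_hom_subproof (X : ubun S) :
  bundle_hom (bundle X) (bundle X) id (starhom_id _).
Proof. by split => // x y. Qed.

Lemma id_proper_subproof (T : topologicalType) : proper_map (@id T).
Proof. by []. Qed.

Definition ubun_id (X : ubun S) : ubun_hom X X :=
  UBunHom (@id_bundle_hom_subproof X) (@id_proper_subproof _).

Section comp.
Context (X Y Z : ubun S) (g : ubun_hom Y Z) (f : ubun_hom X Y).

Lemma comp_bundle_hom_subproof :
  bundle_hom (bundle X) (bundle Z) (base_map g \o base_map f)
    (starhom_comp (sec_map g) (sec_map f)).
Proof.
have [mg hg] := ubun_bundle_hom g; have [mf hf] := ubun_bundle_hom f.
split=> [x y|a1 a2 h e] /=; first exact: le_trans (mg _ _) (mf _ _).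
exact/hg/hf.
Qed.

Lemma comp_proper_subproof : proper_map (base_map g \o base_map f).
Proof. by move=> K cK; exact: ubun_proper (ubun_proper cK). Qed.

Definition ubun_comp : ubun_hom X Z :=
  UBunHom comp_bundle_hom_subproof comp_proper_subproof.

End comp.

Program Definition UBunCStarAlg : category :=
  @Category (ubun S) (@ubun_hom R S) ubun_id ubun_comp _ _ _.
Next Obligation. by move=> X Y f; apply: ubun_homP => //; exact: starhomP. Qed.
Next Obligation. by move=> X Y f; apply: ubun_homP => //; exact: starhomP. Qed.
Next Obligation.
by move=> X Y Z W h g f; apply: ubun_homP => //; exact: starhomP.
Qed.

End ubun_category.

(** * Functorial assignments of extended base spaces *)

(* [C] and [alpha] are total but only their values on the collection [S]
   matter, as do only the values of [Cmap] on proper metric maps in [S].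

   [Cmap f] has to be proper, not just continuous: otherwise
   [(Cmap f, beta)] need not be a morphism between bundles over the spaces
   [C I], not even between zero bundles. Take [S] consisting of
   [I = {1/n | n >= 1}], with [C I = I], and [J = (0, 1]], with
   [C J = [0, 1]]. The inclusion [I -> J] is proper, metric maps [J -> J]
   extend to [C J], and no metric map [J -> I] is proper; but the induced
   inclusion [C I -> C J] is not proper. *)
Record functorial_assignment (R : realType) (S : metricType R -> Prop)
    (C : metricType R -> metricType R)
    (alpha : forall I : metricType R, I -> C I)
    (Cmap : forall I J : metricType R, (I -> J) -> C I -> C J) : Prop := {
  Cmap_continuous : forall (I J : metricType R) (f : I -> J),
    S I -> S J -> metric_map f -> proper_map f -> continuous (Cmap I J f) ;
  Cmap_proper : forall (I J : metricType R) (f : I -> J),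
    S I -> S J -> metric_map f -> proper_map f -> proper_map (Cmap I J f) ;
  Cmap_alpha : forall (I J : metricType R) (f : I -> J),
    S I -> S J -> metric_map f -> proper_map f ->
    Cmap I J f \o alpha I = alpha J \o f ;
  Cmap_comp : forall (I J K : metricType R) (f : I -> J) (g : J -> K),
    S I -> S J -> S K ->
    metric_map f -> proper_map f -> metric_map g -> proper_map g ->
    Cmap I K (g \o f) = Cmap J K g \o Cmap I J f
}.

(* [C @` S]; [set] lives in too small a universe for collections of spaces. *)
Definition image_collection (R : realType) (C : metricType R -> metricType R)
    (S : metricType R -> Prop) : metricType R -> Prop :=
  fun J => exists2 I, S I & C I = J.

Definition ext_obj (R : realType) (S : metricType R -> Prop)
    (C : metricType R -> metricType R)
    (ext : forall X : UBunCStarAlg S, ucb_bundle (C (base X)) (sections X))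
    (X : UBunCStarAlg S) : UBunCStarAlg (image_collection C S) :=
  UBun (ex_intro2 _ _ (base X) (baseP X) erefl) (ext X).

(* Main.v *)
Require Import Defs.
From HB Require Import structures.
From mathcomp Require Import all_boot all_order all_algebra.
From mathcomp Require Import complex generic_quotient ring_quotient ring lra.
From mathcomp Require Import boolp classical_sets reals topology normedtype.
From mathcomp Require Import sequences.

Set Implicit Arguments.
Unset Strict Implicit.
Unset Printing Implicit Defensive.

Import Order.TTheory GRing.Theory Num.Theory.
Import numFieldNormedType.Exports.

Local Open Scope classical_set_scope.
Local Open Scope ring_scope.

(** A morphism [(f, beta)] has to be carried to a morphism [(Cmap f, beta)]
    between the extended bundles. That [Cmap f] is again a metric map, and that
    [Cmap id = id], hold because both are determined on the dense image of the
    base space. The remaining point is that [beta] maps the vanishing ideal at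
    [j] into the vanishing ideal at [Cmap f j]: if the fibre norms of [a] tend
    to [0] along points [i] approaching [j], then so must those of [beta a] at
    the points [f i], which approach [Cmap f j] by continuity. For this one
    compares fibre norms: [beta] induces a *-homomorphism from the fibre over
    [i] to the fibre over [f i], and *-homomorphisms are contractive
    ([starhom_contractive]). Since fibre norms are uniformly continuous on the
    base they have a limit at [f i -> Cmap f j], so a single approach decides
    membership in the ideal.

    Contractivity comes from unitaries. If [h] is self-adjoint of norm less
    than [1], the equation [h^2 + (1 - q)^2 = 1] has a self-adjoint
    solution [q] commuting with [h], found by iterating a contraction
    ([quasi_sqrt]). Its image under a *-homomorphism [f] makes
    [f h +- i (1 - f q)] unitary, and [f h] is their mean; thus
    [`|f h| <= 1] ([starhom_selfadjoint_le1]). The C*-identity then passes from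
    self-adjoint elements to all elements.

    The existence of the extension rests on the limit norm [limit_norm j a],
    the limit of the fibre norms of [a] as the base point approaches [j]. It is
    a C*-seminorm whose null space is the vanishing ideal. Multiplying a section
    by a tent function concentrated near [j] changes it by an element of
    the ideal and brings its norm arbitrarily close to [limit_norm j a]
    ([limit_norm_lift]), so the limit norm is the quotient norm. Hence the
    quotient inherits the C*-identity from the fibres; its completeness is the
    usual argument of lifting a rapidly converging sequence ([squot_complete]).
    Uniform continuity of the fibre norms extends to the limit norms, which
    gives the bundle axioms over the larger base ([limit_bundle],
    [limit_bundle_quotient]). *)

(** * Real-valued norms *)

Lemma complex_ge0E (R : realType) (z : R[i]) :
  0 <= z -> z = (complex.Re z)%:C%C.
Proof. by case: z => x y; rewrite lecE /= => /andP[/eqP -> _]. Qed.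

(** Norms over [R[i]] are nonnegative elements of [R[i]]; taking real parts
    makes them available to the order theory and the decision procedures over
    [R]. *)
Definition rnorm (R : realType) (V : normedModType R[i]) (a : V) : R :=
  complex.Re `|a|.

Section rnorm.
Context (R : realType).

Section normed_module.
Context (V : normedModType R[i]).
Implicit Types a b : V.

Lemma normE a : `|a| = (rnorm a)%:C%C.
Proof. exact: complex_ge0E. Qed.

Lemma rnorm_ge0 a : 0 <= rnorm a.
Proof. by rewrite -lecR -normE normr_ge0. Qed.

Lemma rnorm0 : rnorm (0 : V) = 0.
Proof. by rewrite /rnorm normr0. Qed.

Lemma rnorm0_eq0 a : rnorm a = 0 -> a = 0.
Proof. by move=> a0; apply/normr0_eq0; rewrite normE a0. Qed.

Lemma rnormD a b : rnorm (a + b) <= rnorm a + rnorm b.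
Proof. by rewrite -lecR rmorphD /= -!normE ler_normD. Qed.

Lemma rnormN a : rnorm (- a) = rnorm a.
Proof. by rewrite /rnorm normrN. Qed.

Lemma rnormB a b : rnorm (a - b) = rnorm (b - a).
Proof. by rewrite -rnormN opprB. Qed.

Lemma rnormZ (k : R[i]) a : rnorm (k *: a) = complex.Re `|k| * rnorm a.
Proof.
rewrite {1}/rnorm normrZ (normE a) (complex_ge0E (normr_ge0 k)).
by rewrite -rmorphM.
Qed.

Lemma ball_rnorm a (e : R) b : ball a e%:C%C b = (rnorm (a - b) < e) :> Prop.
Proof. by rewrite -ball_normE /= normE ltcR. Qed.

End normed_module.

Lemma Re_norm_real (r : R) : complex.Re `|r%:C%C| = `|r|.
Proof. by rewrite normc_def /= expr0n addr0 sqrtr_sqr. Qed.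

Lemma rnorm_real (r : R) : rnorm (r%:C%C : R[i]^o) = `|r|.
Proof. exact: Re_norm_real. Qed.

Lemma gt0_complexE (e : R[i]) : 0 < e -> exists2 r : R, 0 < r & e = r%:C%C.
Proof.
move=> e0; exists (complex.Re e); last exact/complex_ge0E/ltW.
by rewrite -ltcR -complex_ge0E ?ltW.
Qed.

Section cstar.
Context (A : cstarAlgType R).
Implicit Types a b : A.

Lemma rnormM a b : rnorm (smul a b) <= rnorm a * rnorm b.
Proof. by rewrite -lecR rmorphM /= -!normE norm_smul. Qed.

Lemma rnorm_cstar a : rnorm (smul (star a) a) = rnorm a ^+ 2.
Proof. by rewrite {1}/rnorm norm_cstar normE -rmorphXn. Qed.

Lemma smul0l a : smul 0 a = 0.
Proof. by have := smulZl 0 (0 : A) a; rewrite !scale0r. Qed.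

Lemma smul0r a : smul a 0 = 0.
Proof. by have := smulZr 0 a (0 : A); rewrite !scale0r. Qed.

Lemma smulNl a b : smul (- a) b = - smul a b.
Proof. by rewrite -scaleN1r smulZl scaleN1r. Qed.

Lemma smulNr a b : smul a (- b) = - smul a b.
Proof. by rewrite -scaleN1r smulZr scaleN1r. Qed.

Lemma smulBl a b c : smul (a - b) c = smul a c - smul b c.
Proof. by rewrite smulDl smulNl. Qed.

Lemma smulBr a b c : smul a (b - c) = smul a b - smul a c.
Proof. by rewrite smulDr smulNr. Qed.

Lemma starZ_real (k : R) a : star (k%:C%C *: a) = k%:C%C *: star a.
Proof.
rewrite starZ conj_Creal // realE -[0]/(0%:C%C) !lecR.
exact: le_total.
Qed.

Lemma starN a : star (- a) = - star a.
Proof. by rewrite -scaleN1r starZ rmorphN1 scaleN1r. Qed.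

Lemma starB a b : star (a - b) = star a - star b.
Proof. by rewrite starD starN. Qed.

Lemma star0 : star (0 : A) = 0.
Proof. by rewrite -[in LHS](subrr (0 : A)) starB subrr. Qed.

(** Cancel [rnorm a] in [rnorm a ^+ 2 <= rnorm (star a) * rnorm a]. *)
Lemma rnorm_star_le a : rnorm a <= rnorm (star a).
Proof.
have := rnormM (star a) a; rewrite rnorm_cstar.
have := rnorm_ge0 a; rewrite le_eqVlt => /predU1P[<- _|a0].
  exact: rnorm_ge0.
by rewrite expr2 ler_pM2r.
Qed.

Lemma rnorm_star a : rnorm (star a) = rnorm a.
Proof.
apply/eqP; rewrite eq_le rnorm_star_le andbT.
by rewrite -{2}(starK a) rnorm_star_le.
Qed.

End cstar.

Section starhom.
Context (A B : cstarAlgType R) (f : starhom A B).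

Lemma starhomD a b : f (a + b) = f a + f b.
Proof. by have := starhom_linear f 1 a b; rewrite !scale1r. Qed.

Lemma starhom0 : f 0 = 0.
Proof. by apply: (addrI (f 0)); rewrite -starhomD !addr0. Qed.

Lemma starhomZ k a : f (k *: a) = k *: f a.
Proof. by have := starhom_linear f k a 0; rewrite !addr0 starhom0 addr0. Qed.

Lemma starhomN a : f (- a) = - f a.
Proof. by rewrite -scaleN1r starhomZ scaleN1r. Qed.

Lemma starhomB a b : f (a - b) = f a - f b.
Proof. by rewrite starhomD starhomN. Qed.

Lemma starhom_eq a b : f a = f b <-> f (a - b) = 0.
Proof.
by rewrite starhomB; split=> [->|/eqP]; rewrite ?subrr // subr_eq0 => /eqP.
Qed.

End starhom.

End rnorm.

(** * Geometric convergence *)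

Lemma geometric_small (R : realType) (c r e : R) : 0 <= r -> r < 1 -> 0 < e ->
  exists N, forall n, (N <= n)%N -> c * r ^+ n < e.
Proof.
move=> r0 r1 e0.
have : (fun n => c * r ^+ n) @ \oo --> (0 : R).
  by apply: cvg_geometric; rewrite ger0_norm.
move=> /cvgr_lt/(_ e e0)[N _ NP]; exists N => n; exact: NP.
Qed.

(** The explicit rate makes a later passage to the limit an estimate against
    [c * r ^+ n], without continuity of the operations involved. *)
Lemma geometric_cvg (R : realType) (V : completeNormedModType R[i])
    (u : nat -> V) (c r : R) : 0 <= r -> r < 1 ->
  (forall n, rnorm (u n.+1 - u n) <= c * r ^+ n) ->
  exists l, forall n, rnorm (l - u n) <= c / (1 - r) * r ^+ n.
Proof.
move=> r0 r1 uc.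
have d0 : 0 < 1 - r by rewrite subr_gt0.
have c0 : 0 <= c.
  by have := uc 0%N; rewrite expr0 mulr1; apply: le_trans; exact: rnorm_ge0.
have step n k : rnorm (u (n + k)%N - u n) <= c / (1 - r) * r ^+ n.
  suff : rnorm (u (n + k)%N - u n) <= c / (1 - r) * r ^+ n * (1 - r ^+ k).
    move/le_trans; apply; rewrite ler_piMr ?lerBlDr ?lerDl ?exprn_ge0 //.
    by rewrite !mulr_ge0 ?exprn_ge0 ?invr_ge0 // ltW.
  elim: k => [|k IH].
    by rewrite addn0 subrr rnorm0 expr0 subrr mulr0.
  have -> : u (n + k.+1)%N - u n =
      (u (n + k).+1 - u (n + k)%N) + (u (n + k)%N - u n).
    by rewrite addrA subrK addnS.
  apply: le_trans (rnormD _ _) _; apply: le_trans (lerD (uc _) IH) _.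
  rewrite exprD exprS le_eqVlt; apply/orP; left; apply/eqP; field.
  by rewrite gt_eqF.
pose F := u @ \oo.
have cF : cauchy F.
  apply/cauchy_exP => _ /gt0_complexE[e e0 ->].
  have [N NP] := geometric_small (c / (1 - r)) r0 r1 e0.
  exists (u N), N => // n /= Nn; rewrite /= ball_rnorm rnormB.
  by rewrite -(subnKC Nn); apply: le_lt_trans (step _ _) _; exact: NP.
have /cvg_ex[l Fl] : [cvg F in V] by exact: cauchy_cvg.
exists l => n; apply/ler_addgt0Pr => e e0.
have /cvg_ballP/(_ e%:C%C) := Fl.
rewrite ltcR => /(_ e0)[N _ /(_ (n + N)%N)]; rewrite /= leq_addl => /(_ isT).
rewrite ball_rnorm => lt.
have -> : l - u n = (u (n + N)%N - u n) + (l - u (n + N)%N).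
  by rewrite [RHS]addrC addrA subrK.
by apply: le_trans (rnormD _ _) _; apply: lerD (step _ _) (ltW lt).
Qed.

Lemma rnorm_small_eq0 (R : realType) (V : normedModType R[i]) (a : V)
    (c r : R) : 0 <= r -> r < 1 ->
  (forall n, rnorm a <= c * r ^+ n) -> a = 0.
Proof.
move=> r0 r1 ac; apply: rnorm0_eq0; apply/eqP.
rewrite eq_le rnorm_ge0 andbT; apply/ler_addgt0Pr => e e0; rewrite add0r.
have [N /(_ N (leqnn N)) lt] := geometric_small c r0 r1 e0.
exact: le_trans (ac N) (ltW lt).
Qed.

(** * *-homomorphisms are contractive *)

(** In the unitization the equation reads [(1 - q)^2 = 1 - h^2]. It is the
    fixed point equation of [q |-> (h^2 + q^2) / 2], which maps the ball of
    radius [r = `|h|^2 < 1] to itself and is [r]-Lipschitz there. All iterates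
    from [0] are polynomials in [h^2], so they are self-adjoint and commute with
    [h], and so does their limit. *)
Lemma quasi_sqrt (R : realType) (A : cstarAlgType R) (h : A) :
  star h = h -> rnorm h < 1 ->
  exists q : A, [/\ star q = q, smul q h = smul h q &
    q + q - smul q q = smul h h].
Proof.
move=> hs h1; pose s := smul h h; pose r := rnorm h ^+ 2.
have r0 : 0 <= r by rewrite exprn_ge0 ?rnorm_ge0.
have r1 : r < 1 by rewrite expr_lt1 ?rnorm_ge0.
have sr : rnorm s <= r by rewrite /r expr2 rnormM.
pose T (q : A) := (2^-1 : R)%:C%C *: (s + smul q q).
pose u n := iter n T 0.
have rT q : rnorm (T q) = 2^-1 * rnorm (s + smul q q).
  by rewrite rnormZ Re_norm_real ger0_norm // invr_ge0 ler0n.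
have ur n : rnorm (u n) <= r.
  elim: n => [|n IH]; first by rewrite rnorm0.
  rewrite /= rT; have := rnormD s (smul (u n) (u n)).
  have := rnormM (u n) (u n); have := rnorm_ge0 (u n).
  by rewrite -/(u n); nra.
have TB p q : rnorm p <= r -> rnorm q <= r ->
    rnorm (T p - T q) <= r * rnorm (p - q).
  move=> pr qr.
  have -> : T p - T q =
      (2^-1 : R)%:C%C *: (smul p (p - q) + smul (p - q) q).
    by rewrite -scalerBr opprD addrACA subrr add0r smulBl smulBr addrA subrK.
  rewrite rnormZ Re_norm_real ger0_norm ?invr_ge0 ?ler0n //.
  have := rnormD (smul p (p - q)) (smul (p - q) q).
  have := rnormM p (p - q); have := rnormM (p - q) q.
  by have := rnorm_ge0 (p - q); nra.
have uS n : rnorm (u n.+1 - u n) <= rnorm (u 1) * r ^+ n.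
  elim: n => [|n IH]; first by rewrite subr0 expr0 mulr1.
  apply: le_trans (TB _ _ (ur n.+1) (ur n)) _.
  by rewrite exprS mulrCA ler_wpM2l.
have [q qu] := geometric_cvg r0 r1 uS.
have qr : rnorm q <= r.
  apply/ler_addgt0Pr => e e0.
  have [N /(_ N (leqnn N)) lt] :=
    geometric_small (rnorm (u 1) / (1 - r)) r0 r1 e0.
  have := rnormD (q - u N) (u N); rewrite subrK.
  by have := qu N; have := ur N; lra.
pose c := rnorm (u 1) / (1 - r).
have us n : star (u n) = u n.
  elim: n => [|n IH]; first exact: star0.
  by rewrite [u n.+1]iterS -/(u n) /T starZ_real starD !starM hs IH.
have uh n : smul (u n) h = smul h (u n).
  elim: n => [|n IH]; first by rewrite smul0l smul0r.
  rewrite /= /T smulZl smulZr smulDl smulDr -/(u n); congr (_ *: (_ + _)).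
    by rewrite -smulA.
  by rewrite -smulA IH !smulA IH.
exists q; split.
- apply/eqP; rewrite -subr_eq0; apply/eqP.
  apply: (@rnorm_small_eq0 _ _ _ (2 * c) r) => // n.
  have -> : star q - q = star (q - u n) - (q - u n).
    by rewrite starB us opprB addrA subrK.
  apply: le_trans (rnormD _ _) _; rewrite rnormN rnorm_star.
  by have := qu n; rewrite -/c; lra.
- apply/eqP; rewrite -subr_eq0; apply/eqP.
  apply: (@rnorm_small_eq0 _ _ _ (2 * c) r) => // n.
  have -> : smul q h - smul h q = smul (q - u n) h - smul h (q - u n).
    by rewrite smulBl smulBr uh opprB addrA subrK.
  apply: le_trans (rnormD _ _) _; rewrite rnormN.
  have := rnormM (q - u n) h; have := rnormM h (q - u n).
  have := qu n; rewrite -/c; have := rnorm_ge0 (q - u n).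
  by have := rnorm_ge0 h; nra.
- have fixed : T q = q.
    apply/eqP; rewrite -subr_eq0; apply/eqP.
    apply: (@rnorm_small_eq0 _ _ _ (2 * c) r) => // n.
    have -> : T q - q = (T q - T (u n)) - (q - u n.+1).
      by rewrite opprB addrA subrK.
    apply: le_trans (rnormD _ _) _; rewrite rnormN.
    have := TB _ _ qr (ur n); have := qu n; have := qu n.+1; rewrite -/c exprS.
    have := rnorm_ge0 (q - u n); have : 0 <= r ^+ n by rewrite exprn_ge0.
    have : 0 <= c by rewrite mulr_ge0 ?rnorm_ge0 // invr_ge0 subr_ge0 ltW.
    move: (r ^+ n) => rn; nra.
  have -> : q + q = s + smul q q.
    have -> : q + q = T q + T q by rewrite fixed.
    rewrite /T -scalerDl -rmorphD /=.
    have -> : 2^-1 + 2^-1 = 1 :> R by lra.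
    by rewrite scale1r.
  by rewrite addrK.
Qed.

(** The cross terms of [star (x + i y) (x + i y)] cancel. *)
Lemma rnorm_add_imaginary (R : realType) (A : cstarAlgType R) (i : R[i])
    (x y : A) :
  i * i^* = 1 -> i + i^* = 0 -> smul (star x) y = smul (star y) x ->
  rnorm (x + i *: y) ^+ 2 = rnorm (smul (star x) x + smul (star y) y).
Proof.
move=> ii1 ii0 xy; rewrite -rnorm_cstar; congr rnorm.
rewrite starD starZ !(smulDl, smulDr, smulZl, smulZr) -xy.
rewrite scalerA [_ * i]mulrC ii1 scale1r addrA.
by rewrite -[X in X + _]addrA -scalerDl ii0 scale0r addr0.
Qed.

(** With [q] from [quasi_sqrt], the elements [f h +- i (1 - f q)] are unitaries
    of the unitization. The algebra need not have a unit, so they are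
    used through their action by left multiplication on an element [w]. *)
Lemma starhom_selfadjoint_le1 (R : realType) (A B : cstarAlgType R)
    (f : starhom A B) (h : A) :
  star h = h -> rnorm h < 1 -> rnorm (f h) <= 1.
Proof.
move=> hs h1; have [q [qs qh qE]] := quasi_sqrt hs h1.
pose k := f h; pose p := f q.
have ks : star k = k by rewrite -starhom_star hs.
have ps : star p = p by rewrite -starhom_star qs.
have pk : smul p k = smul k p by rewrite -!starhomM qh.
have pE : p + p - smul p p = smul k k.
  by rewrite -!starhomM -qE starhomB starhomD.
have isometric (i : R[i]) w : i * i^* = 1 -> i + i^* = 0 ->
    rnorm (smul k w + i *: (w - smul p w)) = rnorm w.
  move=> ii1 ii0; set y := w - smul p w; set x := smul k w.
  have xy : smul (star x) y = smul (star y) x.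
    rewrite /x /y starB !starM ks ps !(smulBl, smulBr) -!smulA.
    by congr (_ - smul _ _); rewrite !smulA pk.
  have xxyy : smul (star x) x + smul (star y) y = smul (star w) w.
    have -> : smul (star x) x = smul (star w) (smul (p + p - smul p p) w).
      by rewrite pE /x starM ks !smulA.
    rewrite /y starB starM ps !(smulBl, smulBr, smulDl, smulDr) -!smulA.
    set b := smul _ (smul p w); set c := smul _ (smul p _).
    by rewrite -[_ - b - _]addrA -opprD [b + (b - c)]addrA addrCA subrr addr0.
  apply/eqP; rewrite -(@eqrXn2 _ 2) ?rnorm_ge0 //.
  by rewrite rnorm_add_imaginary // xxyy rnorm_cstar.
(* [f h] is the mean of the two unitaries. *)
have kw w : rnorm (smul k w) <= rnorm w.
  have iC : 'i^* = - 'i :> R[i] := conjCi _.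
  have xp : rnorm (smul k w + 'i *: (w - smul p w)) = rnorm w.
    by apply: isometric; rewrite iC ?subrr // mulrN -expr2 sqrCi opprK.
  have xm : rnorm (smul k w - 'i *: (w - smul p w)) = rnorm w.
    rewrite -scaleNr; apply: isometric; rewrite rmorphN /= iC opprK ?addNr //.
    by rewrite mulNr -expr2 sqrCi opprK.
  have : smul k w = (2^-1 : R)%:C%C *: ((smul k w + 'i *: (w - smul p w)) +
      (smul k w - 'i *: (w - smul p w))).
    rewrite addrACA subrr addr0 -mulr2n.
    rewrite -scalerMnr scalerMnl -rmorphMn /= -mulr_natr mulVf ?pnatr_eq0 //.
    by rewrite scale1r.
  move=> ->; rewrite rnormZ Re_norm_real ger0_norm ?invr_ge0 ?ler0n //.
  have := rnormD (smul k w + 'i *: (w - smul p w))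
    (smul k w - 'i *: (w - smul p w)).
  by rewrite xm xp; lra.
(* With [w = k], the C*-identity gives [`|k| ^ 2 <= `|k|]. *)
have := kw k; have := rnorm_cstar k; rewrite ks => ->.
by have := rnorm_ge0 k; nra.
Qed.

(** By scaling, self-adjoint elements do not grow in norm; apply this to
    [star a * a]. *)
Lemma starhom_contractive (R : realType) (A B : cstarAlgType R)
    (f : starhom A B) (a : A) : rnorm (f a) <= rnorm a.
Proof.
have selfadjoint (h : A) : star h = h -> rnorm (f h) <= rnorm h.
  move=> hs; apply/ler_addgt0Pr => e e0; pose t := rnorm h + e.
  have t0 : 0 < t by rewrite ltr_wpDl ?rnorm_ge0.
  have nt (V : normedModType R[i]) (b : V) :
      rnorm (t^-1%:C%C *: b) = rnorm b / t.
    by rewrite rnormZ Re_norm_real ger0_norm ?invr_ge0 ?ltW // mulrC.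
  have := @starhom_selfadjoint_le1 _ _ _ f (t^-1%:C%C *: h).
  rewrite starZ_real hs starhomZ !nt ltr_pdivrMr // ler_pdivrMr // !mul1r.
  by apply=> //; rewrite ltrDl.
have := selfadjoint (smul (star a) a).
rewrite starM starK => /(_ erefl).
by rewrite starhomM starhom_star !rnorm_cstar ler_pXn2r ?nnegrE ?rnorm_ge0.
Qed.

(** [q] factors through the surjection [p] as a *-homomorphism, to which
    contractivity applies. *)
Lemma rnorm_factor_le (R : realType) (A P Q : cstarAlgType R)
    (p : starhom A P) (q : starhom A Q) (a : A) :
  (forall b, exists a, p a = b) ->
  (forall a1 a2, p a1 = p a2 -> q a1 = q a2) ->
  rnorm (q a) <= rnorm (p a).
Proof.
move=> /choice[s sK] pq; pose g := q \o s.
have gp a1 : g (p a1) = q a1 by apply: pq; rewrite sK.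
have gl : linear g.
  move=> k b c; rewrite -(sK b) -(sK c) -starhomZ -starhomD !gp.
  by rewrite starhomD starhomZ.
have gM : {morph g : b c / smul b c}.
  by move=> b c; rewrite -(sK b) -(sK c) -starhomM !gp starhomM.
have gs : {morph g : b / star b}.
  by move=> b; rewrite -(sK b) -starhom_star !gp starhom_star.
by have := starhom_contractive (StarHom gl gM gs) (p a); rewrite /= gp.
Qed.

(** * Quotient by a C*-seminorm *)

(** [snorm_lift] says that the seminorm is the quotient norm of its null space.
    Completeness of the quotient depends on it; the C*-identity of the quotient
    is inherited from [snorm_cstar]. *)
Record cstar_seminorm (R : realType) (A : cstarAlgType R) := CstarSeminorm {
  snorm :> A -> R ;
  snormD : forall a b, snorm (a + b) <= snorm a + snorm b ;
  snormZ : forall (k : R[i]) a, snorm (k *: a) = complex.Re `|k| * snorm a ;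
  snormM : forall a b, snorm (smul a b) <= snorm a * snorm b ;
  snorm_cstar : forall a, snorm (smul (star a) a) = snorm a ^+ 2 ;
  snorm_le : forall a, snorm a <= rnorm a ;
  snorm_lift : forall a e, 0 < e ->
    exists2 k, snorm k = 0 & rnorm (a + k) < snorm a + e
}.

Section cstar_seminorm.
Local Open Scope quotient_scope.
Context (R : realType) (A : cstarAlgType R) (N : cstar_seminorm A).

Lemma snorm0 : N 0 = 0.
Proof. by rewrite -(scale0r (0 : A)) snormZ normr0 mul0r. Qed.

Lemma snormN a : N (- a) = N a.
Proof. by rewrite -scaleN1r snormZ normrN1 mul1r. Qed.

Lemma snormB a b : N (a - b) = N (b - a).
Proof. by rewrite -snormN opprB. Qed.

Lemma snorm_ge0 a : 0 <= N a.
Proof. by have := snormD N a (- a); rewrite subrr snorm0 snormN; lra. Qed.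

Lemma snorm_star a : N (star a) = N a.
Proof.
have le b : N b <= N (star b).
  have := snormM N (star b) b; rewrite snorm_cstar.
  have := snorm_ge0 b; rewrite le_eqVlt => /predU1P[<- _|b0].
    exact: snorm_ge0.
  by rewrite expr2 ler_pM2r.
by apply/eqP; rewrite eq_le le andbT -{2}(starK a) le.
Qed.

Lemma snorm_eq a b : N (a - b) = 0 -> N a = N b.
Proof.
move=> ab; have := snormD N (a - b) b; have := snormD N (b - a) a.
by rewrite !subrK -(snormB a b) ab; lra.
Qed.

Definition snull : {pred A} := fun a => N a == 0.

Lemma snull_zmod_closed : zmod_closed snull.
Proof.
split=> [|a b]; rewrite /snull !unfold_in ?snorm0 //.
move=> /eqP a0 /eqP b0; rewrite eq_le snorm_ge0 andbT.
by have := snormD N a (- b); rewrite snormN a0 b0 addr0.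
Qed.

HB.instance Definition _ := GRing.isZmodClosed.Build A snull snull_zmod_closed.

Definition squot : Type := Quotient.quot snull.

HB.instance Definition _ := GRing.Zmodule.on squot.

Definition squot_pi (a : A) : squot := \pi_(Quotient.quot snull) a.
Definition squot_repr (x : squot) : A := repr (x : Quotient.quot snull).

Local Notation pi := squot_pi.
Local Notation rep := squot_repr.

Lemma squot_reprK x : pi (rep x) = x.
Proof. exact: reprK. Qed.

Lemma squot_piP a b : pi a = pi b <-> N (a - b) = 0.
Proof.
have := Quotient.idealrBE snull a b; rewrite unfold_in /snull => e.
split=> [ab|/eqP ab]; first by apply/eqP; rewrite e; apply/eqP.
by apply/eqP; rewrite -e.
Qed.

Lemma squot_piD a b : pi (a + b) = pi a + pi b.
Proof. by rewrite /pi !piE. Qed.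

Lemma squot_piN a : pi (- a) = - pi a.
Proof. by rewrite /pi !piE. Qed.

Lemma squot_pi0 : pi 0 = 0.
Proof. by rewrite /pi !piE. Qed.

(** Reduces every identity in the quotient to representatives. *)
Lemma squot_ind (P : squot -> Prop) : (forall a, P (pi a)) -> forall x, P x.
Proof. by move=> H x; rewrite -(squot_reprK x). Qed.

Lemma snorm_repr a : N (rep (pi a)) = N a.
Proof. by apply/snorm_eq/squot_piP; rewrite squot_reprK. Qed.

Lemma snorm_repr_sub a : N (rep (pi a) - a) = 0.
Proof. by apply/squot_piP; rewrite squot_reprK. Qed.

Definition squot_scale (k : R[i]) x := pi (k *: rep x).
Definition squot_mul x y := pi (smul (rep x) (rep y)).
Definition squot_star x := pi (star (rep x)).
Definition squot_norm x : R[i] := (N (rep x))%:C%C.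

Lemma squot_scaleE k a : squot_scale k (pi a) = pi (k *: a).
Proof.
by apply/squot_piP; rewrite -scalerBr snormZ snorm_repr_sub mulr0.
Qed.

Lemma squot_mulE a b : squot_mul (pi a) (pi b) = pi (smul a b).
Proof.
apply/squot_piP; apply/eqP; rewrite eq_le snorm_ge0 andbT.
have -> : smul (rep (pi a)) (rep (pi b)) - smul a b =
    smul (rep (pi a)) (rep (pi b) - b) + smul (rep (pi a) - a) b.
  by rewrite smulBl smulBr addrA subrK.
apply: le_trans (snormD _ _ _) _.
apply: le_trans (lerD (snormM _ _ _) (snormM _ _ _)) _.
by rewrite !snorm_repr_sub mulr0 mul0r addr0.
Qed.

Lemma squot_starE a : squot_star (pi a) = pi (star a).
Proof. by apply/squot_piP; rewrite -starB snorm_star snorm_repr_sub. Qed.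

Lemma squot_normE a : squot_norm (pi a) = (N a)%:C%C.
Proof. by rewrite /squot_norm snorm_repr. Qed.

Lemma squot_scaleA k l x :
  squot_scale k (squot_scale l x) = squot_scale (k * l) x.
Proof. by elim/squot_ind: x => a; rewrite !squot_scaleE scalerA. Qed.

Lemma squot_scale1 : left_id 1 squot_scale.
Proof. by elim/squot_ind=> a; rewrite squot_scaleE scale1r. Qed.

Lemma squot_scaleDr : right_distributive squot_scale +%R.
Proof.
move=> k; elim/squot_ind=> a; elim/squot_ind=> b.
by rewrite -squot_piD !squot_scaleE -squot_piD scalerDr.
Qed.

Lemma squot_scaleDl x : {morph squot_scale^~ x : k l / k + l}.
Proof.
elim/squot_ind: x => a k l.
by rewrite !squot_scaleE -squot_piD scalerDl.
Qed.

HB.instance Definition _ := GRing.Zmodule_isLmodule.Build R[i] squot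
  squot_scaleA squot_scale1 squot_scaleDr squot_scaleDl.

Lemma squot_piZ k a : pi (k *: a) = k *: pi a.
Proof. by rewrite -squot_scaleE. Qed.

Lemma squot_normD x y : squot_norm (x + y) <= squot_norm x + squot_norm y.
Proof.
elim/squot_ind: x => a; elim/squot_ind: y => b.
by rewrite -squot_piD !squot_normE -rmorphD lecR snormD.
Qed.

Lemma squot_normZ (k : R[i]) x : squot_norm (k *: x) = `|k| * squot_norm x.
Proof.
elim/squot_ind: x => a; rewrite -squot_piZ !squot_normE snormZ.
by rewrite [in RHS](complex_ge0E (normr_ge0 k)) -rmorphM.
Qed.

Lemma squot_norm0_eq0 x : squot_norm x = 0 -> x = 0.
Proof.
elim/squot_ind: x => a; rewrite squot_normE => -[a0].
by rewrite -squot_pi0; apply/squot_piP; rewrite subr0.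
Qed.

HB.instance Definition _ := Lmodule_isNormed.Build R[i] squot
  squot_normD squot_normZ squot_norm0_eq0.

Lemma rnorm_squot_pi a : rnorm (pi a : squot) = N a.
Proof. by rewrite /rnorm [`|_|]squot_normE. Qed.

Lemma squot_lift (x : squot) e : 0 < e ->
  exists2 a, pi a = x & rnorm a < rnorm x + e.
Proof.
elim/squot_ind: x => a e0; have [k k0 lt] := snorm_lift N a e0.
exists (a + k); last by rewrite rnorm_squot_pi.
by apply/squot_piP; rewrite addrAC subrr add0r.
Qed.

(** Pick [x n] in the quotient such that the filter contains the ball of radius
    [2^-n] around it, lift the differences [x n.+1 - x n] with almost no loss of
    norm, and sum the lifts: the partial sums converge in [A], and the image of
    their limit is the limit of the filter. *)
Lemma squot_complete (F : set_system squot) :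
  ProperFilter F -> cauchy F -> cvg F.
Proof.
move=> PF cF.
have h0 : 0 <= 2^-1 :> R by rewrite invr_ge0.
have h1 : 2^-1 < 1 :> R by rewrite invf_lt1 // ltr1n.
have hn n : 0 < (2^-1 : R) ^+ n by rewrite exprn_gt0 // invr_gt0.
have /choice[x xP] : forall n, exists x : squot,
    F (ball x ((2^-1 : R) ^+ n)%:C%C).
  by move=> n; apply: ((cauchyP F).1 cF); rewrite ltcR.
have xd n : rnorm (x n.+1 - x n) <= 2 * 2^-1 ^+ n.
  have [y [yn yS]] := filter_ex (filterI (xP n) (xP n.+1)).
  move: yn yS; rewrite !ball_rnorm (rnormB (x n)) exprS.
  have := rnormD (x n.+1 - y) (y - x n); rewrite addrA subrK.
  by have := hn n; lra.
have /choice[b bP] n : exists b, pi b = x n.+1 - x n /\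
    rnorm b <= 3 * 2^-1 ^+ n.
  have [b bE lt] := squot_lift (x n.+1 - x n) (hn n); exists b; split=> //.
  by have := xd n; lra.
pose a n := rep (x 0%N) + \sum_(k < n) b k.
have ax n : pi (a n) = x n.
  elim: n => [|n IH]; first by rewrite /a big_ord0 addr0 squot_reprK.
  rewrite /a big_ord_recr addrA /= squot_piD -/(a n) IH (bP n).1.
  by rewrite addrC subrK.
have aS n : rnorm (a n.+1 - a n) <= 3 * 2^-1 ^+ n.
  rewrite /a big_ord_recr /= opprD addrACA subrr add0r addrAC subrr add0r.
  exact: (bP n).2.
have [l al] := geometric_cvg h0 h1 aS.
apply/cvg_ex; exists (pi l); apply/cvg_ballP => _ /gt0_complexE[e e0 ->].
have [n nP] := geometric_small (3 / (1 - 2^-1) + 1) h0 h1 e0.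
apply: filterS (xP n) => y; rewrite !ball_rnorm => lt.
have := rnormD (pi l - x n) (x n - y).
rewrite addrA subrK => /le_lt_trans; apply.
have : rnorm (pi l - x n) <= rnorm (l - a n).
  by rewrite -(ax n) -squot_piN -squot_piD rnorm_squot_pi snorm_le.
by have := nP n (leqnn n); have := al n; rewrite mulrDl; lra.
Qed.

HB.instance Definition _ := Uniform_isComplete.Build squot squot_complete.

Lemma squot_smulA x y z :
  squot_mul x (squot_mul y z) = squot_mul (squot_mul x y) z.
Proof.
elim/squot_ind: x => a; elim/squot_ind: y => b; elim/squot_ind: z => c.
by rewrite !squot_mulE smulA.
Qed.

Lemma squot_smulDl x y z :
  squot_mul (x + y) z = squot_mul x z + squot_mul y z.
Proof.
elim/squot_ind: x => a; elim/squot_ind: y => b; elim/squot_ind: z => c.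
by rewrite -squot_piD !squot_mulE -squot_piD smulDl.
Qed.

Lemma squot_smulDr x y z :
  squot_mul x (y + z) = squot_mul x y + squot_mul x z.
Proof.
elim/squot_ind: x => a; elim/squot_ind: y => b; elim/squot_ind: z => c.
by rewrite -squot_piD !squot_mulE -squot_piD smulDr.
Qed.

Lemma squot_smulZl (k : R[i]) x y : squot_mul (k *: x) y = k *: squot_mul x y.
Proof.
elim/squot_ind: x => a; elim/squot_ind: y => b.
by rewrite -(squot_piZ k a) !squot_mulE -squot_piZ smulZl.
Qed.

Lemma squot_smulZr (k : R[i]) x y : squot_mul x (k *: y) = k *: squot_mul x y.
Proof.
elim/squot_ind: x => a; elim/squot_ind: y => b.
by rewrite -(squot_piZ k b) !squot_mulE -squot_piZ smulZr.
Qed.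

Lemma squot_starK x : squot_star (squot_star x) = x.
Proof. by elim/squot_ind: x => a; rewrite !squot_starE starK. Qed.

Lemma squot_starD x y : squot_star (x + y) = squot_star x + squot_star y.
Proof.
elim/squot_ind: x => a; elim/squot_ind: y => b.
by rewrite -squot_piD !squot_starE -squot_piD starD.
Qed.

Lemma squot_starZ (k : R[i]) x : squot_star (k *: x) = k^* *: squot_star x.
Proof.
elim/squot_ind: x => a.
by rewrite -(squot_piZ k a) !squot_starE -squot_piZ starZ.
Qed.

Lemma squot_starM x y :
  squot_star (squot_mul x y) = squot_mul (squot_star y) (squot_star x).
Proof.
elim/squot_ind: x => a; elim/squot_ind: y => b.
by rewrite (squot_mulE a b) !squot_starE squot_mulE starM.
Qed.

Lemma squot_norm_smul x y : `|squot_mul x y : squot| <= `|x| * `|y|.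
Proof.
elim/squot_ind: x => a; elim/squot_ind: y => b.
by rewrite squot_mulE !normE !rnorm_squot_pi -rmorphM lecR snormM.
Qed.

Lemma squot_norm_cstar x : `|squot_mul (squot_star x) x : squot| = `|x| ^+ 2.
Proof.
elim/squot_ind: x => a; rewrite squot_starE squot_mulE !normE.
by rewrite !rnorm_squot_pi snorm_cstar rmorphXn.
Qed.

HB.instance Definition _ := CompleteNormedModule_isCStarAlgebra.Build R squot
  squot_smulA squot_smulDl squot_smulDr squot_smulZl squot_smulZr
  squot_starK squot_starD squot_starZ squot_starM
  squot_norm_smul squot_norm_cstar.

Lemma squot_pi_linear : linear (pi : A -> squot).
Proof. by move=> k a b; rewrite squot_piD squot_piZ. Qed.

Lemma squot_pi_mul : {morph (pi : A -> squot) : a b / smul a b}.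
Proof. by move=> a b; rewrite -squot_mulE. Qed.

Lemma squot_pi_star : {morph (pi : A -> squot) : a / star a}.
Proof. by move=> a; rewrite -squot_starE. Qed.

Definition squot_proj : starhom A squot :=
  StarHom squot_pi_linear squot_pi_mul squot_pi_star.

End cstar_seminorm.

(** * Uniform continuity and fibre norms *)

Section ucb.
Context (R : realType) (I : metricType R).

Lemma ball_mdist (x : I) d y : ball x d y = (mdist x y < d) :> Prop.
Proof. by rewrite ballEmdist. Qed.

Lemma unif_continuous_mdistP (f : I -> R[i]^o) : unif_continuous f <->
  forall e, 0 < e -> exists2 d, 0 < d &
    forall x y, mdist x y < d -> rnorm (f x - f y) < e.
Proof.
have fF : Filter ((fun xy => (f xy.1, f xy.2)) @ entourage_ (@ball _ I)).
  by rewrite entourage_ballE; apply: fmap_filter.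
rewrite /unif_continuous -!entourage_ballE filter_fromP; split=> uf.
  move=> e e0; have [|d d0 dP] := uf e%:C%C; first by rewrite /= ltcR.
  exists d => // x y xy; have := dP (x, y); rewrite /= ball_mdist => /(_ xy).
  by rewrite ball_rnorm.
move=> _ /gt0_complexE[e e0 ->]; have [d d0 dP] := uf e e0.
exists d => // -[x y] /=; rewrite ball_mdist => /dP.
by rewrite ball_rnorm.
Qed.

Lemma UCbP (f : I -> R[i]^o) : UCb f <->
  (exists M, forall x, rnorm (f x) <= M) /\
  (forall e, 0 < e -> exists2 d, 0 < d &
    forall x y, mdist x y < d -> rnorm (f x - f y) < e).
Proof.
rewrite -unif_continuous_mdistP.
split=> [[[M [_ fM]] uf]|[[M fM] uf]]; split=> //.
  exists (complex.Re (M + 1)) => x.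
  have : `|f x| <= M + 1 by apply: fM => //; rewrite ltrDl.
  by case: (M + 1) => a b; rewrite normE lecE => /andP[].
exists M%:C%C; split=> [|N MN x _].
  by rewrite realE -[0]/(0%:C%C) !lecR; exact: le_total.
by rewrite /= normE (le_trans _ (ltW MN)) // lecR.
Qed.

End ucb.

(** The supremum of an empty or unbounded set is [0]. *)
Lemma sup_range_ge0 (R : realType) (T : Type) (f : T -> R) :
  (forall t, 0 <= f t) -> 0 <= sup (range f).
Proof.
move=> f0; have [hs|n] := pselect (has_sup (range f)); last by rewrite sup_out.
have [[y [t _ ty]] _] := hs; apply: le_trans (f0 t) _.
by apply: sup_upper_bound => //; exists t.
Qed.

Lemma sup_range_le (R : realType) (T : Type) (f : T -> R) c : 0 <= c ->
  (forall t, f t <= c) -> sup (range f) <= c.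
Proof.
move=> c0 fc; have [[x rx]|n0] := pselect (range f !=set0).
  by apply: ge_sup; [exists x|move=> _ [t _ <-]].
by rewrite sup_out // => -[].
Qed.

Section fiber_norm.
Context (R : realType) (I : metricType R) (A : cstarAlgType R).
Context (E : ucb_bundle I A).

Definition fiber_norm (i : I) (a : A) : R := rnorm (proj E i a).

Lemma fiber_norm_ge0 i a : 0 <= fiber_norm i a.
Proof. exact: rnorm_ge0. Qed.

Lemma fiber_norm_unif a e : 0 < e -> exists2 d, 0 < d &
  forall x y, mdist x y < d -> `|fiber_norm x a - fiber_norm y a| < e.
Proof.
move=> e0; have [_ /(_ e e0)[d d0 dP]] := (UCbP _).1 (bundle_norm E a).
exists d => // x y /dP.
by rewrite !normE -rmorphB rnorm_real.
Qed.

Lemma fiber_norm_le i a : fiber_norm i a <= rnorm a.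
Proof.
have [[M MP] _] := (UCbP _).1 (bundle_norm E a).
rewrite /rnorm (bundle_sup E); apply: ub_le_sup; last by exists i.
exists M => _ [x _ <-]; apply: le_trans (MP x).
by rewrite normE rnorm_real ler_norm.
Qed.

Lemma rnorm_le_fiber_norm a c : 0 <= c -> (forall i, fiber_norm i a <= c) ->
  rnorm a <= c.
Proof. by move=> c0 ac; rewrite /rnorm (bundle_sup E); exact: sup_range_le. Qed.

Lemma fiber_normD i a b :
  fiber_norm i (a + b) <= fiber_norm i a + fiber_norm i b.
Proof. by rewrite /fiber_norm starhomD rnormD. Qed.

Lemma fiber_normZ i k a :
  fiber_norm i (k *: a) = complex.Re `|k| * fiber_norm i a.
Proof. by rewrite /fiber_norm starhomZ rnormZ. Qed.

Lemma fiber_normM i a b :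
  fiber_norm i (smul a b) <= fiber_norm i a * fiber_norm i b.
Proof. by rewrite /fiber_norm starhomM rnormM. Qed.

Lemma fiber_norm_cstar i a :
  fiber_norm i (smul (star a) a) = fiber_norm i a ^+ 2.
Proof. by rewrite /fiber_norm starhomM starhom_star rnorm_cstar. Qed.

End fiber_norm.

Lemma tails_filter (D : Type) (le : D -> D -> Prop) :
  directed_order le -> ProperFilter (tails le).
Proof.
case=> -[d0] le_refl le_trans le_dir; split; first by move=> [d /(_ d)]; exact.
split=> [|P Q [p pP] [q qQ]|P Q PQ [p pP]].
- by exists d0.
- have [r [pr qr]] := le_dir p q; exists r => d rd.
  by split; [apply: pP|apply: qQ]; exact: le_trans rd.
- by exists p => d /pP/PQ.
Qed.

Section vanishing.
Context (R : realType) (I J : metricType R) (A : cstarAlgType R).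
Context (alpha : I -> J) (alpha_dense : dense (range alpha)).
Context (E : ucb_bundle I A).

Lemma dense_mdist (j : J) d : 0 < d -> exists i, mdist j (alpha i) < d.
Proof.
move=> d0; have [||y [jd [i _ iy]]] := @alpha_dense (ball j d)^°.
- by exists j; exact: nbhsx_ballx.
- exact: open_interior.
by exists i; have := interior_subset jd; rewrite ball_mdist iy.
Qed.

(** One net detects vanishing: the pairs [(d, i)] with [mdist j (alpha i) < d],
    directed by decreasing [d], project to a net through every base point close
    to [j]. *)
Lemma vanishing_idealP (j : J) (a : A) : vanishing_ideal alpha E j a <->
  forall e, 0 < e -> exists2 d, 0 < d &
    forall i, mdist j (alpha i) < d -> fiber_norm E i a < e.
Proof.
split=> [va e e0|va D le x led xj].
  pose D := {p : R * I | 0 < p.1 /\ mdist j (alpha p.2) < p.1}.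
  pose le (p q : D) := (sval q).1 <= (sval p).1.
  pose x (p : D) := (sval p).2.
  have inD d : 0 < d -> exists p : D, (sval p).1 = d.
    move=> d0; have [i id] := dense_mdist j d0.
    by exists (exist _ (d, i) (conj d0 id)).
  have dle : directed_order le.
    split.
    - by have [p _] := inD 1 ltr01.
    - by move=> p; rewrite /le.
    - by move=> p q r pq qr; exact: le_trans qr pq.
    - move=> p q; have [|r rE] := inD (Num.min (sval p).1 (sval q).1).
        by rewrite lt_min (svalP p).1 (svalP q).1.
      by exists r; rewrite /le rE !ge_min !lexx orbT.
  have FF := tails_filter dle.
  have xj : alpha (x p) @[p --> tails le] --> j.
    apply/cvg_ballP => d d0; have [p pd] := inD d d0; exists p => q pq.
    rewrite /= ball_mdist; apply: lt_le_trans (svalP q).2 _.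
    by rewrite -pd.
  have := va D le x dle xj.
  move=> /cvgr0Pnorm_lt/(_ e%:C%C); rewrite ltcR => /(_ e0)[p pP].
  exists (sval p).1 => [|i ip]; first exact: (svalP p).1.
  have := pP (exist _ ((sval p).1, i) (conj (svalP p).1 ip)) (lexx _).
  by rewrite normr_id /= normE ltcR.
have FF := tails_filter led.
apply/cvgr0Pnorm_lt => _ /gt0_complexE[e e0 ->].
have [d d0 dP] := va e e0.
have /cvg_ballP/(_ d d0) := xj; apply: filterS => p; rewrite ball_mdist => /dP.
by rewrite normr_id normE ltcR.
Qed.

End vanishing.

(** * Limits of fibre norms *)

Section limit_norm.
Context (R : realType) (I J : metricType R) (A : cstarAlgType R).
Context (alpha : I -> J) (emb : dense_isometric_embedding alpha).
Context (E : ucb_bundle I A).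

Let alpha_isometry : forall x y, mdist (alpha x) (alpha y) = mdist x y := emb.1.
Let alpha_dense : dense (range alpha) := emb.2.

Definition approach (j : J) : set_system I :=
  filter_from [set d : R | 0 < d] (fun d => [set i | mdist j (alpha i) < d]).

#[local] Instance approach_filter j : ProperFilter (approach j).
Proof.
apply: filter_from_proper => [|d d0]; last first.
  by have [i ij] := dense_mdist alpha_dense j d0; exists i.
apply: filter_from_filter; first by exists 1; exact: ltr01.
move=> d e d0 e0; exists (Num.min d e); first by rewrite /= lt_min d0 e0.
by move=> i /=; rewrite lt_min => /andP.
Qed.

Definition limit_norm (j : J) (a : A) : R :=
  lim (fiber_norm E i a @[i --> approach j]).

Lemma mdist_preimage j x y d :
  mdist j (alpha x) < d / 2 -> mdist j (alpha y) < d / 2 -> mdist x y < d.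
Proof.
move=> jx jy; have := metric_triangle (alpha x) j (alpha y).
by rewrite alpha_isometry (metric_sym (alpha x)); lra.
Qed.

(** As [alpha] is isometric, base points approaching [j] are close to
    each other, so uniform continuity makes the fibre norms Cauchy. *)
Lemma limit_norm_cvg j a :
  fiber_norm E i a @[i --> approach j] --> limit_norm j a.
Proof.
suff : cvg (fiber_norm E i a @[i --> approach j]) by [].
apply: cauchy_cvg; apply/cauchy_exP => e e0.
have [d d0 dP] := fiber_norm_unif E a e0.
have d20 : 0 < d / 2 by rewrite divr_gt0.
have [i ij] := dense_mdist alpha_dense j d20.
exists (fiber_norm E i a), (d / 2) => // x /= xj.
by apply: dP; exact: mdist_preimage xj.
Qed.

Lemma limit_norm_near j a e : 0 < e -> exists2 d, 0 < d &
  forall i, mdist j (alpha i) < d -> `|limit_norm j a - fiber_norm E i a| < e.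
Proof. by move=> e0; have /cvgrPdist_lt/(_ e e0) := @limit_norm_cvg j a. Qed.

Lemma limit_norm_unique j a l :
  fiber_norm E i a @[i --> approach j] --> l -> limit_norm j a = l.
Proof. exact: (cvg_unique (@Rhausdorff R) (@limit_norm_cvg j a)). Qed.

Lemma limit_norm_alpha i a : limit_norm (alpha i) a = fiber_norm E i a.
Proof.
apply: limit_norm_unique; apply/cvgrPdist_lt => e e0.
have [d d0 dP] := fiber_norm_unif E a e0; exists d => // x.
by rewrite /= alpha_isometry => /dP.
Qed.

Lemma limit_norm_ge0 j a : 0 <= limit_norm j a.
Proof.
apply: limr_ge; first exact: limit_norm_cvg.
by apply: nearW => i; exact: fiber_norm_ge0.
Qed.

Lemma limit_norm_le j a : limit_norm j a <= rnorm a.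
Proof.
apply: limr_le; first exact: limit_norm_cvg.
by apply: nearW => i; exact: fiber_norm_le.
Qed.

Lemma limit_normD j a b :
  limit_norm j (a + b) <= limit_norm j a + limit_norm j b.
Proof.
apply: ler_cvg_to (@limit_norm_cvg j _)
  (cvgD (@limit_norm_cvg j a) (@limit_norm_cvg j b)) _.
by apply: nearW => i; exact: fiber_normD.
Qed.

Lemma limit_normZ j k a :
  limit_norm j (k *: a) = complex.Re `|k| * limit_norm j a.
Proof.
apply: limit_norm_unique.
under eq_fun do rewrite fiber_normZ.
by apply: cvgMr; exact: limit_norm_cvg.
Qed.

Lemma limit_normM j a b :
  limit_norm j (smul a b) <= limit_norm j a * limit_norm j b.
Proof.
apply: ler_cvg_to (@limit_norm_cvg j _)
  (cvgM (@limit_norm_cvg j a) (@limit_norm_cvg j b)) _.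
by apply: nearW => i; exact: fiber_normM.
Qed.

Lemma limit_norm_cstar j a :
  limit_norm j (smul (star a) a) = limit_norm j a ^+ 2.
Proof.
apply: limit_norm_unique.
under eq_fun do rewrite fiber_norm_cstar expr2.
by rewrite expr2; apply: cvgM; exact: limit_norm_cvg.
Qed.

Lemma limit_norm_eq0P j a :
  limit_norm j a = 0 <-> vanishing_ideal alpha E j a.
Proof.
rewrite (vanishing_idealP alpha_dense); split=> [a0 e e0|va].
  have [d d0 dP] := limit_norm_near j a e0; exists d => // i /dP.
  by rewrite a0 sub0r normrN ger0_norm ?fiber_norm_ge0.
apply: limit_norm_unique; apply/cvgrPdist_lt => e e0.
have [d d0 dP] := va e e0; exists d => // i /= /dP.
by rewrite sub0r normrN ger0_norm ?fiber_norm_ge0.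
Qed.

(** Multiply [a] by the tent function [g] of height [1] at [j] whose support is
    the [d]-ball around [j]. The difference [g a - a] vanishes at [j], while the
    fibre norms of [g a] exceed [limit_norm j a] by at most [e / 2]: inside
    the ball by the choice of [d], and outside of it because they are [0]. *)
Lemma limit_norm_lift j a e : 0 < e ->
  exists2 k, limit_norm j k = 0 & rnorm (a + k) < limit_norm j a + e.
Proof.
move=> e0; have e20 : 0 < e / 2 by rewrite divr_gt0.
have [d d0 dP] := limit_norm_near j a e20.
pose t i := mdist j (alpha i) / d.
have t0 i : 0 <= t i by rewrite divr_ge0 ?mdist_ge0 // ltW.
pose g i := Num.max 0 (1 - t i).
have g0 i : 0 <= g i by rewrite le_max lexx.
have g1 i : g i <= 1 by rewrite /g; have := t0 i; case: (leP 0 (1 - t i)); lra.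
have gt i : `|g i - 1| <= t i.
  by rewrite /g ler_norml; have := t0 i; case: (leP 0 (1 - t i));
     move=> *; apply/andP; split; lra.
have gU : UCb (fun i => (g i)%:C%C : R[i]^o).
  apply/UCbP; split.
    by exists 1 => i; rewrite rnorm_real ger0_norm.
  move=> r r0; exists (r * d); first by rewrite mulr_gt0.
  move=> x y xy; rewrite -rmorphB rnorm_real.
  have : `|t x - t y| < r.
    rewrite /t -mulrBl normrM [`|d^-1|]gtr0_norm ?invr_gt0 // ltr_pdivrMr //.
    apply: le_lt_trans xy; rewrite ler_norml -alpha_isometry.
    have := metric_triangle j (alpha x) (alpha y).
    have := metric_triangle j (alpha y) (alpha x).
    rewrite (metric_sym (alpha y)) => *; apply/andP; split; lra.
  rewrite /g !ltr_norml => /andP[].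
  by case: (leP 0 (1 - t x)); case: (leP 0 (1 - t y)); move=> *;
     apply/andP; split; lra.
have [fa faP] := bundle_mul E a gU; exists (fa - a).
  apply/limit_norm_eq0P/(vanishing_idealP alpha_dense) => r r0.
  (* The summand [1] keeps the denominator positive. *)
  pose c := rnorm a + 1.
  have c0 : 0 < c by rewrite ltr_wpDl ?rnorm_ge0.
  exists (r * d / c); first by rewrite divr_gt0 ?mulr_gt0.
  move=> i ij; rewrite /fiber_norm starhomB faP -[X in _ - X]scale1r -scalerBl.
  have -> : (g i)%:C%C - 1 = (g i - 1)%:C%C by rewrite rmorphB.
  rewrite rnormZ Re_norm_real.
  have : t i < r / c by rewrite /t ltr_pdivrMr // mulrAC.
  have /= := fiber_norm_le E i a; rewrite /fiber_norm.
  have := rnorm_ge0 (proj E i a); have := gt i; have := normr_ge0 (g i - 1).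
  rewrite ltr_pdivlMr // /c; have := t0 i; have := rnorm_ge0 a; nra.
rewrite [a + _]addrC subrK.
apply: (@le_lt_trans _ _ (limit_norm j a + e / 2)); last by rewrite ltrD2l; lra.
apply: (@rnorm_le_fiber_norm _ _ _ E).
  by rewrite addr_ge0 ?limit_norm_ge0 ?ltW.
move=> i; rewrite /fiber_norm faP rnormZ Re_norm_real ger0_norm //.
have [ij|ij] := ltP (mdist j (alpha i)) d.
  have := dP i ij; rewrite ltr_norml => /andP[+ _].
  have := fiber_norm_ge0 E i a; rewrite /fiber_norm.
  by have := g0 i; have := g1 i; nra.
have -> : g i = 0 by apply: max_l; rewrite subr_le0 ler_pdivlMr // mul1r.
by rewrite mul0r addr_ge0 ?limit_norm_ge0 ?ltW.
Qed.
End limit_norm.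

(** * The bundle of quotients by the vanishing ideals *)

Section extension.
Context (R : realType) (I J : metricType R) (A : cstarAlgType R).
Context (alpha : I -> J) (emb : dense_isometric_embedding alpha).
Context (E : ucb_bundle I A).

Definition limit_seminorm (j : J) : cstar_seminorm A :=
  CstarSeminorm (limit_normD emb E j) (limit_normZ emb E j)
    (limit_normM emb E j) (limit_norm_cstar emb E j) (limit_norm_le emb E j)
    (@limit_norm_lift _ _ _ _ _ emb E j).

Let q (j : J) : starhom A (squot (limit_seminorm j)) :=
  squot_proj (limit_seminorm j).

Let rnorm_q j a : rnorm (q j a) = limit_norm alpha E j a.
Proof. exact: rnorm_squot_pi. Qed.

Let q_surj j (b : squot (limit_seminorm j)) : exists a, q j a = b.
Proof. by exists (squot_repr b); exact: squot_reprK. Qed.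

(** The base points in [I] already reach the supremum, since the limit norm at
    [alpha i] is the fibre norm at [i]. *)
Let q_sup a : complex.Re `|a| = sup (range (fun j => complex.Re `|q j a|)).
Proof.
apply/eqP; rewrite eq_le; apply/andP; split; last first.
  apply: sup_range_le; first exact: (rnorm_ge0 a).
  by move=> j; rewrite [leLHS]rnorm_q limit_norm_le.
apply: (@rnorm_le_fiber_norm _ _ _ E).
  by apply: sup_range_ge0 => j; exact: (rnorm_ge0 (q j a)).
move=> i; apply: ub_le_sup.
  by exists (rnorm a) => _ [j _ <-]; rewrite [leLHS]rnorm_q limit_norm_le.
by exists (alpha i) => //; rewrite [LHS]rnorm_q limit_norm_alpha.
Qed.

Let q_unif a e : 0 < e -> exists2 d, 0 < d & forall j k, mdist j k < d ->
  `|limit_norm alpha E j a - limit_norm alpha E k a| < e.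
Proof.
move=> e0; have e3 : 0 < e / 3 by rewrite divr_gt0.
have [d d0 dP] := fiber_norm_unif E a e3.
have d3 : 0 < d / 3 by rewrite divr_gt0.
exists (d / 3) => // j k jk.
have approx l : exists2 i, mdist l (alpha i) < d / 3 &
    `|limit_norm alpha E l a - fiber_norm E i a| < e / 3.
  have [c c0 cP] := limit_norm_near emb E l a e3.
  have [|i] := dense_mdist emb.2 l (d := Num.min c (d / 3)).
    by rewrite lt_min c0 d3.
  by rewrite lt_min => /andP[ic id]; exists i => //; exact: cP.
have [x xj xP] := approx j; have [y yk yP] := approx k.
have : mdist x y < d.
  rewrite -emb.1; have := metric_triangle (alpha x) j (alpha y).
  have := metric_triangle j k (alpha y).
  by rewrite (metric_sym (alpha x) j); lra.
move=> /dP; move: xP yP; rewrite !ltr_norml => /andP[? ?] /andP[? ?] /andP[? ?].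
by apply/andP; split; lra.
Qed.

Let q_norm a : UCb (fun j => `|q j a| : R[i]^o).
Proof.
apply/UCbP; split.
  exists (rnorm a) => j; rewrite normE rnorm_real ger0_norm ?rnorm_ge0 //.
  by rewrite rnorm_q limit_norm_le.
move=> e /(q_unif a)[d d0 dP]; exists d => // j k /dP.
by rewrite !normE -rmorphB rnorm_real !rnorm_q.
Qed.

(** The product of [a] with the restriction of [f] to [I] also works
    over [J]: as [i] approaches [j], the value [f (alpha i)] tends to [f j]. *)
Let q_mul (f : J -> R[i]^o) a : UCb f ->
  exists fa, forall j, q j fa = f j *: q j a.
Proof.
move=> /UCbP[[M fM] uf].
have [|fa faP] := bundle_mul E (f := f \o alpha) a.
  apply/UCbP; split; first by exists M => i; exact: fM.
  move=> e /uf[d d0 dP]; exists d => // x y xy.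
  by apply: dP; rewrite emb.1.
exists fa => j; apply/eqP; rewrite -subr_eq0 -starhomZ -starhomB.
apply/eqP/rnorm0_eq0; rewrite rnorm_q.
apply/(limit_norm_eq0P emb)/(vanishing_idealP emb.2) => e e0.
pose c := rnorm a + 1.
have c0 : 0 < c by rewrite ltr_wpDl ?rnorm_ge0.
have [|d d0 dP] := uf (e / c); first by rewrite divr_gt0.
exists d => // i /dP; rewrite ltr_pdivlMr //.
rewrite /fiber_norm starhomB faP starhomZ -scalerBl rnormZ /=.
rewrite rnormB; apply: le_lt_trans.
have := fiber_norm_le E i a; rewrite /fiber_norm /c => le.
apply: ler_wpM2l; first exact: (rnorm_ge0 (f (alpha i) - f j : R[i]^o)).
by apply: le_trans le _; rewrite lerDl.
Qed.

Definition limit_bundle : ucb_bundle J A :=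
  Build_ucb_bundle q_surj q_sup q_mul q_norm.

Let q_eq0 j a : q j a = 0 <-> vanishing_ideal alpha E j a.
Proof.
rewrite -(limit_norm_eq0P emb) -rnorm_q.
by split=> [->|/rnorm0_eq0 //]; rewrite rnorm0.
Qed.

Lemma limit_bundle_quotient : quotient_extension alpha E limit_bundle.
Proof.
split.
  split.
  - split=> [x y|a b i ab /=]; first by rewrite emb.1.
    apply/(starhom_eq (q (alpha i)))/rnorm0_eq0.
    rewrite rnorm_q limit_norm_alpha //.
    by rewrite /fiber_norm starhomB ab subrr rnorm0.
  - by [].
  - by move=> O [x Ox] _; exists x; split=> //; exists x.
move=> j; split; [exact: q_surj|exact: q_eq0|move=> a].
rewrite [LHS]rnorm_q; apply/eqP; rewrite eq_le; apply/andP; split.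
  apply: lb_le_inf.
    exists (complex.Re `|a + 0|), 0 => //.
    by apply/q_eq0; rewrite starhom0.
  move=> _ [k /(limit_norm_eq0P emb) k0 <-].
  have := snormD (limit_seminorm j) (a + k) (- k).
  rewrite addrK snormN [X in _ + X]k0 addr0 => /le_trans; apply.
  exact: limit_norm_le.
apply/ler_addgt0Pr => e e0; have [k k0 lt] := limit_norm_lift emb E j a e0.
apply: le_trans (ltW lt); apply: ge_inf.
  by exists 0 => _ [l _ <-]; exact: (rnorm_ge0 (a + l)).
by exists k => //; exact/(limit_norm_eq0P emb).
Qed.

End extension.

(** * Extension of morphisms *)

Section functor.
Context (R : realType).

Lemma continuous_mdist (J K : metricType R) (g : J -> K) j e :
  continuous g -> 0 < e ->
  exists2 d, 0 < d & forall x, mdist j x < d -> mdist (g j) (g x) < e.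
Proof.
move=> /(_ j) /cvg_ballP gc e0.
have /nbhs_ballP[d d0 dP] := gc e e0; exists d => // x.
by rewrite -!ball_mdist => /dP.
Qed.

Section base_map.
Context (I J CI CJ : metricType R) (a : I -> CI) (b : J -> CJ).
Context (ea : dense_isometric_embedding a) (eb : dense_isometric_embedding b).
Context (f : I -> J) (g : CI -> CJ).
Context (gc : continuous g) (gf : g \o a = b \o f).

Let gfE i : g (a i) = b (f i).
Proof. exact: (congr1 (@^~ i) gf). Qed.

Lemma extension_metric_map : metric_map f -> metric_map g.
Proof.
move=> mf x y; apply/ler_addgt0Pr => e e0.
have approx z : exists2 i, mdist z (a i) < e / 4 &
    mdist (g z) (g (a i)) < e / 4.
  have e4 : 0 < e / 4 by rewrite divr_gt0.
  have [d d0 dP] := continuous_mdist z gc e4.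
  have [|i] := dense_mdist ea.2 z (d := Num.min d (e / 4)).
    by rewrite lt_min d0 e4.
  by rewrite lt_min => /andP[id ie]; exists i => //; exact: dP.
have [i ix gi] := approx x; have [k ky gk] := approx y.
have := metric_triangle (g x) (g (a i)) (g y).
have := metric_triangle (g (a i)) (g (a k)) (g y).
have := metric_triangle (a i) x (a k); have := metric_triangle x y (a k).
have : mdist (g (a i)) (g (a k)) <= mdist (a i) (a k).
  by rewrite !gfE eb.1 ea.1.
by rewrite (metric_sym (g (a k)) (g y)) (metric_sym (a i) x); lra.
Qed.

(** Choose [i] near [j] with small fibre norm of [x]; the norm of [beta x] in
    the fibre over [f i] is no larger, and it is close to the limit norm of
    [beta x] at [g j] because [f i] lies near [g j]. As the limit norm is known
    to exist, one such [i] for each error bound is enough. *)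
Lemma extension_vanishing (A B : cstarAlgType R)
    (E : ucb_bundle I A) (E' : ucb_bundle J B) (beta : starhom A B) j x :
  bundle_hom E E' f beta ->
  vanishing_ideal a E j x -> vanishing_ideal b E' (g j) (beta x).
Proof.
move=> [mf hb] /(vanishing_idealP ea.2) vx; apply/(limit_norm_eq0P eb).
apply/eqP; rewrite eq_le limit_norm_ge0 // andbT.
apply/ler_addgt0Pr => e e0; have e2 : 0 < e / 2 by rewrite divr_gt0.
have [c c0 cP] := limit_norm_near eb E' (g j) (beta x) e2.
have [d d0 dP] := continuous_mdist j gc c0; have [r r0 rP] := vx _ e2.
have [|i] := dense_mdist ea.2 j (d := Num.min d r); first by rewrite lt_min d0.
rewrite lt_min => /andP[/dP + /rP xi]; rewrite gfE => /cP.
rewrite ltr_norml => /andP[_].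
have : fiber_norm E' (f i) (beta x) <= fiber_norm E i x.
  rewrite /fiber_norm.
  apply: (rnorm_factor_le (q := starhom_comp (proj E' (f i)) beta)).
    exact: bundle_surj.
  by move=> a1 a2 /hb.
by lra.
Qed.

End base_map.

Lemma extension_id (I CI : metricType R) (a : I -> CI) (g : CI -> CI) :
  dense_isometric_embedding a -> continuous g -> g \o a = a -> g = id.
Proof.
move=> ea gc ga; apply/funext => x; apply: mdist_positivity.
apply/eqP; rewrite eq_le mdist_ge0 andbT; apply/ler_addgt0Pr => e e0.
have e2 : 0 < e / 2 by rewrite divr_gt0.
have [d d0 dP] := continuous_mdist x gc e2.
have [|i] := dense_mdist ea.2 x (d := Num.min d (e / 2)).
  by rewrite lt_min d0 e2.
rewrite lt_min => /andP[/dP + ix]; rewrite [g (a i)](congr1 (@^~ i) ga).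
have := metric_triangle (g x) (a i) x; rewrite (metric_sym (a i) x); lra.
Qed.

Lemma quotient_extension_hom (I J CI CJ : metricType R) (A B : cstarAlgType R)
    (a : I -> CI) (b : J -> CJ) (f : I -> J) (g : CI -> CJ)
    (E : ucb_bundle I A) (E' : ucb_bundle J B) (X : ucb_bundle CI A)
    (X' : ucb_bundle CJ B) (beta : starhom A B) :
  dense_isometric_embedding a -> dense_isometric_embedding b ->
  continuous g -> g \o a = b \o f ->
  quotient_extension a E X -> quotient_extension b E' X' ->
  bundle_hom E E' f beta -> bundle_hom X X' g beta.
Proof.
move=> ea eb gc gf [_ qX] [_ qX'] hb; split.
  by have [mf _] := hb; exact: (extension_metric_map ea eb gc gf mf).
move=> a1 a2 j /starhom_eq; have [_ kX _] := qX j => /kX v.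
apply/starhom_eq; rewrite -starhomB; have [_ kX' _] := qX' (g j).
by apply/kX'; exact: (extension_vanishing ea eb gc gf hb v).
Qed.

End functor.

Theorem proposition5p1 (R : realType)
  (S : metricType R -> Prop)
  (C : metricType R -> metricType R)
  (alpha : forall I : metricType R, I -> C I)
  (Cmap : forall I J : metricType R, (I -> J) -> C I -> C J)
  (S_nonempty : exists I, S I)
  (S_locally_compact : forall I, S I -> locally_compact [set: I])
  (C_locally_compact : forall I, S I -> locally_compact [set: C I])
  (alpha_embedding : forall I, S I -> dense_isometric_embedding (alpha I))
  (C_functorial : functorial_assignment S alpha Cmap) :
  (forall X : UBunCStarAlg S,
     exists E : ucb_bundle (C (base X)) (sections X),
       quotient_extension (alpha (base X)) (bundle X) E) /\
  (forall ext : forall X : UBunCStarAlg S,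
       ucb_bundle (C (base X)) (sections X),
     (forall X, quotient_extension (alpha (base X)) (bundle X) (ext X)) ->
     exists Fm : forall X Y : UBunCStarAlg S,
         mor X Y -> mor (ext_obj ext X) (ext_obj ext Y),
       (forall (X Y : UBunCStarAlg S) (f : mor X Y),
          base_map (Fm X Y f) = Cmap (base X) (base Y) (base_map f) /\
          sec_map (Fm X Y f) = sec_map f) /\
       is_functor Fm).
Proof.
split=> [X|ext extP].
  exists (limit_bundle (alpha_embedding _ (baseP X)) (bundle X)).
  exact: limit_bundle_quotient.
have bundle_homP (X Y : UBunCStarAlg S) (f : mor X Y) :
    bundle_hom (ext X) (ext Y) (Cmap _ _ (base_map f)) (sec_map f).
  have [mf _] := ubun_bundle_hom f; have pf := @ubun_proper _ _ _ _ f.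
  have SX := baseP X; have SY := baseP Y.
  apply: (quotient_extension_hom (alpha_embedding _ SX) (alpha_embedding _ SY)
    _ _ (extP X) (extP Y) (ubun_bundle_hom f)).
    exact: (Cmap_continuous C_functorial SX SY mf pf).
  exact: (Cmap_alpha C_functorial SX SY mf pf).
have properP (X Y : UBunCStarAlg S) (f : mor X Y) :
    proper_map (Cmap _ _ (base_map f)).
  have [mf _] := ubun_bundle_hom f.
  exact: (Cmap_proper C_functorial (baseP X) (baseP Y) mf
    (@ubun_proper _ _ _ _ f)).
pose Fm (X Y : UBunCStarAlg S) (f : mor X Y) :
    mor (ext_obj ext X) (ext_obj ext Y) :=
  @UBunHom R _ (ext_obj ext X) (ext_obj ext Y) _ _ (bundle_homP X Y f)
    (properP X Y f).
exists Fm; split=> //; split=> [X|X Y Z g f]; apply: ubun_homP => //=.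
  have SX := baseP X.
  have idm : metric_map (@id (base X)) by move=> x y.
  have idp : proper_map (@id (base X)) := @id_proper_subproof _.
  apply: (extension_id (alpha_embedding _ SX)).
    exact: (Cmap_continuous C_functorial SX SX idm idp).
  exact: (Cmap_alpha C_functorial SX SX idm idp).
have [mf _] := ubun_bundle_hom f; have [mg _] := ubun_bundle_hom g.
exact: (Cmap_comp C_functorial (baseP X) (baseP Y) (baseP Z)
  mf (@ubun_proper _ _ _ _ f) mg (@ubun_proper _ _ _ _ g)).
Qed.
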